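(* Let $G=\{g_1<\dots<g_{|G|}\}$ and $H=\{h_1<\dots<h_{|H|}\}$ be two finite sets of positive integers, and let $I_G, I_H:\mathbb{Z}\to\mathbb{Z}_{\geq 0}$ be their gap functions. Define the polynomials $$\Delta_G(t) = 1+(t-1)\sum_{j=1}^{|G|} t^{g_j} = 1+(t-1)|G|+(t-1)^2\sum_{j\geq 0} k_j^G t^j,$$ $$\Delta_H(t) = 1+(t-1)\sum_{j=1}^{|H|} t^{h_j} = 1+(t-1)|H|+(t-1)^2\sum_{j\geq 0} k_j^H t^j,$$ where $k_j^G = I_G(j+1)$ and $k_j^H = I_H(j+1)$ for $j\geq 0$. Let $\Delta=\Delta_G\cdot\Delta_H$ and $I = I_G\diamond I_H$. Then $$\Delta(t) = 1+(t-1)(|G|+|H|)+(t-1)^2\sum_{j\geq 0} k_j t^j,$$ where $k_j\leq I(j+1)$ for all $j\geq 0$.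
   Context: For a finite set (equivalently, a finite increasing sequence) $G$ of positive integers, the gap function $I_G:\mathbb{Z}\to\mathbb{Z}_{\geq 0}$ is defined by $$I_G(m)=\left|\{k\in G\cup\mathbb{Z}_{<0} : k\geq m\}\right|,$$ where $\mathbb{Z}_{<0}$ is the set of negative integers. For functions $I_1,I_2:\mathbb{Z}\to\mathbb{Z}_{\geq 0}$, their infimum convolution is $$(I_1\diamond I_2)(k)=\min_{k_1,k_2\in\mathbb{Z},\ k_1+k_2=k}\bigl(I_1(k_1)+I_2(k_2)\bigr),\qquad k\in\mathbb{Z}.$$ The sums over $j\geq 0$ have only finitely many nonzero terms. *)

(* Defs.v *)
From HB Require Import structures.
From mathcomp Require Import all_boot all_order all_algebra.
From mathcomp Require Import finmap.
From mathcomp Require Import boolp classical_sets functions cardinality fsbigop.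

Set Implicit Arguments.
Unset Strict Implicit.
Unset Printing Implicit Defensive.

Import Order.TTheory GRing.Theory Num.Theory.
Local Open Scope classical_set_scope.
Local Open Scope ring_scope.

Definition gap_set (G : {fset nat}) (m : int) : set int :=
  [set k : int | ((exists2 g : nat, g \in G & k = g%:Z) \/ k < 0) /\ m <= k].

(* [fset_set] is [fset0] on infinite sets: this rules that case out. *)
Lemma finite_gap_set (G : {fset nat}) (m : int) : finite_set (gap_set G m).
Proof.
apply: (@sub_finite_set _ _ ([set g%:Z | g in [set` G]] `|`
  [set - n%:Z | n in `I_(`|m|.+1)])).
  move=> k [[[g gG ->]|k0] mk]; first by left; exists g.
  right; exists `|k|%N; last by rewrite abszE ltr0_norm // opprK.
  rewrite /= ltnS -lez_nat !abszE ltr0_norm //.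
  by rewrite (ltr0_norm (le_lt_trans mk k0)) lerN2.
rewrite finite_setU; split; apply: finite_image; last exact: finite_II.
exact: finite_fset.
Qed.

Definition gap_fun (G : {fset nat}) (m : int) : nat := #|` fset_set (gap_set G m)|.

Definition conv_values (I1 I2 : int -> nat) (k : int) : set nat :=
  [set n | exists k1 k2 : int, k1 + k2 = k /\ n = (I1 k1 + I2 k2)%N].

Lemma conv_values_ex (I1 I2 : int -> nat) (k : int) :
  exists n, `[< conv_values I1 I2 k n >].
Proof.
by exists (I1 k + I2 0)%N; apply/asboolP; exists k, 0; rewrite addr0.
Qed.

Definition infconv (I1 I2 : int -> nat) (k : int) : nat :=
  ex_minn (conv_values_ex I1 I2 k).

Definition gap_poly (G : {fset nat}) : {poly int} :=
  1 + ('X - 1) * \sum_(g <- G) 'X^g.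

(* A sum over an infinite support is 0 by convention, so every use of
   [series_poly k] below is paired with the finiteness of the support of [k]. *)
Definition series_poly (k : nat -> int) : {poly int} :=
  \sum_(j \in [set: nat]) k j *: 'X^j.

Definition expands_as (P : {poly int}) (n : nat) (k : nat -> int) : Prop :=
  finite_set [set j | k j != 0] /\
  P = 1 + ('X - 1) * n%:R + ('X - 1) ^+ 2 * series_poly k.

(* Main.v *)
Require Import Defs.
From mathcomp Require Import all_boot all_order all_algebra.
From mathcomp Require Import finmap.
From mathcomp Require Import boolp classical_sets functions cardinality fsbigop.
From mathcomp Require Import zify ring.
Import GRing.Theory.
Local Open Scope ring_scope.

(* Write [A] and [B] for the sums of [t^g] over [G] and of [t^h] over [H].
   Multiplying out, [(1 + (t-1) A) (1 + (t-1) B)] gives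
   [k_j = I_G(j+1) + I_H(j+1) + #{(g, h) | g + h = j}].  If [k1 + k2 = j + 1],
   then each pair with [g + h = j] has [g >= k1] or [h >= k2].  The pairs of the
   first kind inject into the elements [g] of [G] with [k1 <= g <= j], so they are
   at most [I_G(k1) - I_G(j+1)] in number, and symmetrically for the second kind.
   A negative [k1] reduces to [k1 = 0], because [I_G] decreases by exactly 1 at
   each negative step while [I_H] decreases by at most 1. *)

(** Coefficients vanish from [size p] on, so the sum over all of [nat] is a genuine finite sum and
    not the default 0. *)
Lemma series_poly_coef (p : {poly int}) :
  finite_set [set j | p`_j != 0] /\ series_poly (fun j => p`_j) = p.
Proof.
have supp j : p`_j != 0 -> (j < size p)%N.
  by apply: contra_neqT; rewrite -leqNgt => /(nth_default 0).
split; first exact: sub_finite_set (finite_II (size p)).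
rewrite /series_poly -(@fsbig_widen _ _ _ _ `I_(size p)) //.
  by rewrite -fsbig_ord -[RHS]coefK poly_def.
move=> j /= [_] /negP; rewrite -leqNgt => /(nth_default 0) ->.
by rewrite scale0r.
Qed.

Lemma expands_as_coef (P p : {poly int}) (n : nat) (k : nat -> int) :
  (forall j, k j = p`_j) ->
  P = 1 + ('X - 1) * n%:R + ('X - 1) ^+ 2 * p -> expands_as P n k.
Proof.
move=> /funext -> ->; have [fin_p def_p] := series_poly_coef p.
by split; rewrite ?def_p.
Qed.

Lemma gap_fun_size (G : {fset nat}) (m : int) (s : seq int) :
  uniq s -> (forall k, gap_set G m k <-> k \in s) -> gap_fun G m = size s.
Proof.
move=> s_uniq memG; rewrite /gap_fun.
have -> : gap_set G m = [set` [fset k in s]%fset]%classic.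
  by apply/seteqP; split=> k; rewrite /= in_fset => /memG.
by rewrite set_fsetK card_fseq undup_id.
Qed.

Lemma gap_fun_nat (G : {fset nat}) (n : nat) :
  gap_fun G n%:Z = (\sum_(g <- G) (n <= g))%N.
Proof.
rewrite -big_mkcond sum1_count -size_filter -(size_map Posz).
apply: gap_fun_size; first by rewrite map_inj_uniq ?filter_uniq ?fset_uniq // => ? ? [].
move=> k; split=> [[[[g gG ->]|k0] nk]|/mapP[g]].
- by apply: map_f; rewrite mem_filter gG andbT; lia.
- lia.
- by rewrite mem_filter => /andP[ng gG] ->; split; [left; exists g|lia].
Qed.

Lemma gap_fun_opp (G : {fset nat}) (n : nat) :
  gap_fun G (- n%:Z) = (#|` G| + n)%N.
Proof.
(* [Negz i] is [-(i + 1)], so the second list runs through -1, ..., -n. *)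
have -> : (#|` G| + n)%N
    = size ([seq g%:Z | g <- G] ++ [seq Negz i | i <- iota 0 n]).
  by rewrite size_cat !size_map size_iota.
apply: gap_fun_size.
  rewrite cat_uniq !map_inj_uniq ?iota_uniq ?fset_uniq ?andbT /=;
    try by move=> ? ? [].
  by apply/hasPn => _ /mapP[i _ ->]; apply/mapP => -[].
move=> k; rewrite mem_cat; split=> [[[[g gG ->]|k0] nk]|/orP[]/mapP[i]].
- by rewrite map_f.
- case: k k0 nk => // i _ nk; apply/orP; right; apply: map_f.
  by rewrite mem_iota; lia.
- by move=> iG ->; split; [left; exists i|lia].
- by rewrite mem_iota => i_n ->; split; [right|lia].
Qed.

(** Raising the threshold by one drops only the entries equal to the old threshold, at most one
    since [s] has no duplicates. *)
Lemma sum_geq_shift (s : seq nat) (m n : nat) :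
  uniq s -> (\sum_(h <- s) (m <= h) <= \sum_(h <- s) (m + n <= h) + n)%N.
Proof.
move=> s_uniq; elim: n => [|n IHn]; first by rewrite addn0 addn0.
apply: leq_trans IHn _; rewrite addnS addnS -addSn leq_add2r.
apply: (@leq_trans (\sum_(h <- s) (m + n < h) + \sum_(h <- s) (h == m + n))).
  by rewrite -big_split; apply: leq_sum => h _ /=; lia.
rewrite -[(\sum_(h <- s) (h == _))%N]big_mkcond sum1_count count_uniq_mem //.
by rewrite -[leqRHS]addn1 leq_add2l leq_b1.
Qed.

(** This holds for each [g] separately. If [g < p] then [g <= j], and both terms vanish; if [g > j],
    no [h] completes [g] to [j]; otherwise only [h = j - g] does. *)
Lemma sum_pairs_geq (r s : seq nat) (p j : nat) : uniq s -> (p <= j.+1)%N ->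
  (\sum_(g <- r) (j < g) + \sum_(g <- r) \sum_(h <- s) ((p <= g) && (g + h == j))
   <= \sum_(g <- r) (p <= g))%N.
Proof.
move=> s_uniq pj; rewrite -big_split; apply: leq_sum => g _ /=.
have [pg|gp] /= := leqP p g; last by rewrite big1_eq; lia.
have [jg|gj] := ltnP j g.
  by rewrite big1_seq // => h _; lia.
rewrite (eq_bigr (fun h => nat_of_bool (pred1 (j - g)%N h))); last first.
  by move=> h _ /=; congr nat_of_bool; lia.
by rewrite -big_mkcond sum1_count count_uniq_mem // leq_b1.
Qed.

Lemma sum_pairs_leq (r s : seq nat) (p q j : nat) :
  uniq r -> uniq s -> (p + q = j.+1)%N ->
  (\sum_(g <- r) (j < g) + \sum_(h <- s) (j < h)
     + \sum_(g <- r) \sum_(h <- s) (g + h == j)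
   <= \sum_(g <- r) (p <= g) + \sum_(h <- s) (q <= h))%N.
Proof.
move=> r_uniq s_uniq pqj.
have /(sum_pairs_geq r s p j s_uniq) le_r : (p <= j.+1)%N by lia.
have /(sum_pairs_geq s r q j r_uniq) le_s : (q <= j.+1)%N by lia.
rewrite exchange_big /= in le_s.
apply: leq_trans (leq_add le_r le_s); rewrite addnACA leq_add2l -big_split /=.
(* As [p + q = j + 1], having both [g < p] and [h < q] would give [g + h < j]. *)
apply: leq_sum => g _; rewrite -big_split /=; apply: leq_sum => h _.
by lia.
Qed.

Lemma pairs_le_gap_fun_opp (G H : {fset nat}) (n j : nat) :
  (\sum_(g <- G) (j < g) + \sum_(h <- H) (j < h)
     + \sum_(g <- G) \sum_(h <- H) (g + h == j)
   <= gap_fun G (- n%:Z) + gap_fun H (j.+1 + n)%:Z)%N.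
Proof.
(* With thresholds 0 and [j + 1] the first sum is the size of [G]; the extra [n] in
   [gap_fun G (- n)] pays for moving the threshold in [H] up by [n]. *)
apply: leq_trans (sum_pairs_leq G H 0 j.+1 j _ _ _) _; rewrite ?fset_uniq //.
rewrite (eq_bigr (fun=> 1%N)) // sum1_size gap_fun_opp gap_fun_nat -addnA.
rewrite leq_add2l addnC.
exact: sum_geq_shift (fset_uniq H).
Qed.

Lemma pairs_le_gap_fun (G H : {fset nat}) (j : nat) (k1 k2 : int) :
  k1 + k2 = (j.+1)%:Z ->
  (\sum_(g <- G) (j < g) + \sum_(h <- H) (j < h)
     + \sum_(g <- G) \sum_(h <- H) (g + h == j)
   <= gap_fun G k1 + gap_fun H k2)%N.
Proof.
(* The sum is positive, so [k1] and [k2] are not both negative. *)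
case: k1 => [p|n]; case: k2 => [q|m] sum_k; last by lia.
- by rewrite !gap_fun_nat; apply: sum_pairs_leq; rewrite ?fset_uniq //; lia.
- have -> : Posz p = (j.+1 + m.+1)%N%:Z by lia.
  have -> : (\sum_(g <- G) \sum_(h <- H) (g + h == j)
             = \sum_(h <- H) \sum_(g <- G) (h + g == j))%N.
    rewrite exchange_big; apply: eq_bigr => h _; apply: eq_bigr => g _.
    by rewrite addnC.
  rewrite NegzE [leqRHS]addnC [X in (X + _ <= _)%N]addnC.
  exact: pairs_le_gap_fun_opp.
- have -> : Posz q = (j.+1 + n.+1)%N%:Z by lia.
  exact: pairs_le_gap_fun_opp.
Qed.

(** The inner sum is the quotient of [t^g - 1] by [t - 1]; the coefficient of [t^j] in the total is
    [I_G(j+1)]. *)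
Definition tail_poly (G : {fset nat}) : {poly int} :=
  \sum_(g <- G) \sum_(i < g) 'X^i.

Lemma coef_tail_poly (G : {fset nat}) (j : nat) :
  (tail_poly G)`_j = (\sum_(g <- G) (j < g))%N%:Z.
Proof.
rewrite coef_sum -natz natr_sum; apply: eq_bigr => g _.
have -> : \sum_(i < g) 'X^i = \poly_(i < g) (1 : int).
  by rewrite poly_def; apply: eq_bigr => i _; rewrite scale1r.
by rewrite coef_poly; case: ltnP.
Qed.

Lemma sum_polyXn (G : {fset nat}) :
  \sum_(g <- G) 'X^g = #|` G|%:R + ('X - 1) * tail_poly G :> {poly int}.
Proof.
rewrite mulr_sumr -sum1_size natr_sum -big_split; apply: eq_bigr => g _ /=.
by rewrite -subrX1 addrC subrK.
Qed.

Lemma coef_mul_sum_polyXn (G H : {fset nat}) (j : nat) :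
  ((\sum_(g <- G) 'X^g) * (\sum_(h <- H) 'X^h) : {poly int})`_j
  = (\sum_(g <- G) \sum_(h <- H) (g + h == j))%N%:Z.
Proof.
rewrite -natz natr_sum mulr_suml coef_sum; apply: eq_bigr => g _.
rewrite natr_sum mulr_sumr coef_sum; apply: eq_bigr => h _.
by rewrite -exprD coefXn eq_sym.
Qed.

Lemma expands_as_gap_poly (G : {fset nat}) :
  expands_as (gap_poly G) #|` G| (fun j => (gap_fun G (j.+1)%:Z)%:Z).
Proof.
apply: (expands_as_coef _ (tail_poly G)) => [j|].
  by rewrite gap_fun_nat coef_tail_poly.
by rewrite /gap_poly sum_polyXn; ring.
Qed.

Theorem theorem2 (G H : {fset nat})
    (Gpos : forall g : nat, g \in G -> (0 < g)%N)
    (Hpos : forall h : nat, h \in H -> (0 < h)%N) :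
  [/\ expands_as (gap_poly G) #|` G| (fun j => (gap_fun G (j.+1)%:Z)%:Z),
      expands_as (gap_poly H) #|` H| (fun j => (gap_fun H (j.+1)%:Z)%:Z)
    & exists k : nat -> int,
        expands_as (gap_poly G * gap_poly H) (#|` G| + #|` H|)%N k /\
        forall j : nat,
          k j <= (infconv (gap_fun G) (gap_fun H) (j.+1)%:Z)%:Z].
Proof.
split; [exact: expands_as_gap_poly | exact: expands_as_gap_poly |].
(* The product is [1 + (t-1)(A + B) + (t-1)^2 A B]; splitting [A] and [B] in the linear term by
   [sum_polyXn] leaves this factor of [(t-1)^2]. *)
pose p := tail_poly G + tail_poly H
          + (\sum_(g <- G) 'X^g) * (\sum_(h <- H) 'X^h).
exists (fun j => p`_j); split.
  apply: (expands_as_coef _ p) => //.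
  by rewrite /gap_poly /p natrD !sum_polyXn; ring.
(* The minimum is attained at some [k1], [k2], so a bound valid for every decomposition of [j + 1]
   suffices. *)
move=> j; rewrite /infconv; case: ex_minnP => n /asboolP[k1 [k2 [sum_k ->]]] _.
rewrite /p !coefD !coef_tail_poly coef_mul_sum_polyXn -!PoszD lez_nat.
exact: pairs_le_gap_fun.
Qed.
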